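(* Let $A,\Delta A\in\mathbb{R}^{n\times m}$, $\widetilde A=A+\Delta A$, $1\le r<\min\{n,m\}$, $\operatorname{rank}(A)\ge r$, and assume $\sigma_r-\widetilde\sigma_{r+1}>0$ and $\widetilde\sigma_r-\sigma_{r+1}>0$. Then \[\|\sin\Theta(U_1,\widetilde U_1)\|\le\min\Big\{\frac{\widetilde\sigma_r\|(\Delta A)\widetilde V_1\|+\sigma_{r+1}\|(\Delta A)^T\widetilde U_1\|}{\widetilde\sigma_r^2-\sigma_{r+1}^2},\ \frac{\sigma_r\|(\Delta A)V_1\|+\widetilde\sigma_{r+1}\|U_1^T(\Delta A)\|}{\sigma_r^2-\widetilde\sigma_{r+1}^2}\Big\},\] \[\|\sin\Theta(V_1,\widetilde V_1)\|\le\min\Big\{\frac{\widetilde\sigma_r\|\widetilde U_1^T(\Delta A)\|+\sigma_{r+1}\|(\Delta A)\widetilde V_1\|}{\widetilde\sigma_r^2-\sigma_{r+1}^2},\ \frac{\sigma_r\|U_1^T(\Delta A)\|+\widetilde\sigma_{r+1}\|(\Delta A)V_1\|}{\sigma_r^2-\widetilde\sigma_{r+1}^2}\Big\}.\] Moreover, \[\max\{\|\sin\Theta(U_1,\widetilde U_1)\|,\|\sin\Theta(V_1,\widetilde V_1)\|\}\le\min\Big\{\frac{1}{\sigma_r-\widetilde\sigma_{r+1}},\frac{1}{\widetilde\sigma_r-\sigma_{r+1}}\Big\}\|\Delta A\|.\]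
   Context: $\sigma_1\ge\sigma_2\ge\dots$ and $\widetilde\sigma_1\ge\widetilde\sigma_2\ge\dots$ are the singular values of $A$ and $\widetilde A$ (set to $0$ for indices exceeding $\min\{n,m\}$). $U_1\in\mathbb{R}^{n\times r}$, $V_1\in\mathbb{R}^{m\times r}$ are matrices whose columns are the leading $r$ left, resp. right, singular vectors of $A$ (from a full SVD $A=U\Sigma V^T$), and $\widetilde U_1,\widetilde V_1$ are the analogous matrices for $\widetilde A$. $\|\cdot\|$ is the spectral norm. For $X,\widetilde X\in\mathbb{R}^{d\times r}$ with orthonormal columns, if $\zeta_1\ge\dots\ge\zeta_r$ are the singular values of $X^T\widetilde X$, then $\sin\Theta(X,\widetilde X)=\mathrm{diag}(\sqrt{1-\zeta_1^2},\dots,\sqrt{1-\zeta_r^2})$. *)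

(* Defs.v *)
From HB Require Import structures.
From mathcomp Require Import all_boot all_order all_algebra.
From mathcomp Require Import classical_sets reals.
From Stdlib Require Import ClassicalEpsilon.
Set Implicit Arguments. Unset Strict Implicit. Unset Printing Implicit Defensive.
Import Order.TTheory GRing.Theory Num.Theory.
Local Open Scope ring_scope.

Section Defs.
Variable R : realType.

Definition enorm q (x : 'cV[R]_q) : R := Num.sqrt (\sum_(i < q) x i 0 ^+ 2).

Definition opnorm p q (M : 'M[R]_(p, q)) : R :=
  sup [set y : R | exists x : 'cV[R]_q, enorm x = 1 /\ y = enorm (M *m x)]%classic.

Definition is_svd p q (M : 'M[R]_(p, q)) (U : 'M[R]_p) (S : 'M[R]_(p, q))
    (V : 'M[R]_q) : Prop :=
  [/\ U^T *m U = 1%:M /\ V^T *m V = 1%:M,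
      (forall (i : 'I_p) (j : 'I_q), (i : nat) != j -> S i j = 0),
      (forall (i : 'I_p) (j : 'I_q), (i : nat) = j -> 0 <= S i j),
      (forall (i i' : 'I_p) (j j' : 'I_q), (i : nat) = j -> (i' : nat) = j' ->
          (i <= i')%N -> S i' j' <= S i j)
    & M = U *m S *m V^T].

(* k-th (1-indexed) diagonal entry of a rectangular diagonal matrix,
   0 for k = 0 or k > min p q. *)
Definition sv p q (S : 'M[R]_(p, q)) (k : nat) : R :=
  if [pick ij : 'I_p * 'I_q | [&& (0 < k)%N, (ij.1 : nat) == k.-1 & (ij.2 : nat) == k.-1]]
  is Some ij then S ij.1 ij.2 else 0.

(* Singular values of an arbitrary matrix: diagonal of (a chosen) full SVD;
   sval M k = sigma_k(M), 1-indexed, 0 beyond min p q. *)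
Definition sval p q (M : 'M[R]_(p, q)) (k : nat) : R :=
  sv (epsilon (inhabits (0 : 'M[R]_(p, q)))
        (fun S => exists U V, is_svd M U S V)) k.

Definition leadcols p r (U : 'M[R]_p) : 'M[R]_(p, r) :=
  \matrix_(i < p, j < r) \sum_(l < p | (l : nat) == j) U i l.

Definition sinTheta d r (X Xt : 'M[R]_(d, r)) : 'M[R]_r :=
  \matrix_(i < r, j < r)
     (if i == j then Num.sqrt (1 - sval (X^T *m Xt) i.+1 ^+ 2) else 0).

End Defs.

(* Main.v *)
Require Import Defs.
From HB Require Import structures.
From mathcomp Require Import all_boot all_order all_algebra ring lra.
From mathcomp Require Import boolp classical_sets reals topology normedtype derive.
From Stdlib Require Import ClassicalEpsilon.
Import Order.TTheory GRing.Theory Num.Theory.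
Import numFieldNormedType.Exports.
Local Open Scope ring_scope.

(* Let P = 1 - U1 U1^T and Q = 1 - V1 V1^T, so that P A = A Q, and put
   Z = P Ut1, W = Q Vt1.  With D the diagonal of the r leading singular values
   of A + dA, multiplying the singular vector equations of A + dA by P and Q
   gives
     Z D = A W + P (dA Vt1),   W D = A^T Z + Q (dA^T Ut1).
   As A restricted to the range of Q and A^T restricted to the range of P have
   norm at most s_{r+1}, this yields
     st_r |Z| <= s_{r+1} |W| + |dA Vt1|,  st_r |W| <= s_{r+1} |Z| + |dA^T Ut1|,
   and eliminating |W| bounds |Z|.  If U1^T Ut1 q = zeta p with p, q unit
   singular vectors, then Pythagoras gives 1 - zeta^2 = |Z q|^2, whence
   |sin Theta| <= |Z|.  The other bounds follow by exchanging A with A + dA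
   and by transposing. *)

(** * Euclidean and operator norms *)

Section Euclidean.
Set Implicit Arguments.
Unset Strict Implicit.
Context {R : realType}.

Lemma enorm_ge0 q (x : 'cV[R]_q) : 0 <= enorm x.
Proof. exact: sqrtr_ge0. Qed.

Lemma enorm_sqr q (x : 'cV[R]_q) : enorm x ^+ 2 = (x^T *m x) 0 0.
Proof.
rewrite /enorm sqr_sqrtr; last by apply: sumr_ge0 => i _; exact: sqr_ge0.
by rewrite mxE; apply: eq_bigr => i _; rewrite !mxE expr2.
Qed.

Lemma enorm_sqr_sum q (x : 'cV[R]_q) : enorm x ^+ 2 = \sum_i x i 0 ^+ 2.
Proof. by rewrite enorm_sqr mxE; apply: eq_bigr => i _; rewrite !mxE expr2. Qed.

Lemma dotC q (x y : 'cV[R]_q) : (x^T *m y) 0 0 = (y^T *m x) 0 0.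
Proof. by rewrite !mxE; apply: eq_bigr => i _; rewrite !mxE mulrC. Qed.

Lemma enorm_le_sqr p q (x : 'cV[R]_p) (y : 'cV[R]_q) :
  enorm x ^+ 2 <= enorm y ^+ 2 -> enorm x <= enorm y.
Proof. by rewrite ler_pXn2r // nnegrE enorm_ge0. Qed.

Lemma enorm_eq p q (x : 'cV[R]_p) (y : 'cV[R]_q) :
  enorm x ^+ 2 = enorm y ^+ 2 -> enorm x = enorm y.
Proof. by move=> /eqP; rewrite eqrXn2 ?enorm_ge0 // => /eqP. Qed.

Lemma enorm_eq0 q (x : 'cV[R]_q) : enorm x = 0 -> x = 0.
Proof.
move=> x0; have := enorm_sqr_sum x; rewrite x0 expr0n /= => /esym/eqP.
rewrite psumr_eq0 => [/allP h|i _]; last exact: sqr_ge0.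
apply/matrixP => i j; rewrite ord1 mxE; apply/eqP.
by have := h i (mem_index_enum _); rewrite sqrf_eq0.
Qed.

Lemma enorm0 q : enorm (0 : 'cV[R]_q) = 0.
Proof. by apply/eqP; rewrite -sqrf_eq0 enorm_sqr mulmx0 mxE. Qed.

Lemma enormZ q (a : R) (x : 'cV[R]_q) : enorm (a *: x) = `|a| * enorm x.
Proof.
apply/eqP; rewrite -(@eqrXn2 _ 2) ?mulr_ge0 ?normr_ge0 ?enorm_ge0 //.
rewrite exprMn real_normK ?num_real // !enorm_sqr_sum mulr_sumr.
by apply/eqP/eq_bigr => i _; rewrite mxE exprMn.
Qed.

Lemma enormN q (x : 'cV[R]_q) : enorm (- x) = enorm x.
Proof. by rewrite -scaleN1r enormZ normrN1 mul1r. Qed.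

Lemma enorm_sqrD q (x y : 'cV[R]_q) :
  enorm (x + y) ^+ 2 = enorm x ^+ 2 + 2 * (x^T *m y) 0 0 + enorm y ^+ 2.
Proof.
rewrite !enorm_sqr [(x + y)^T]linearD mulmxDl !mulmxDr.
have addE (M N : 'M[R]_1) : (M + N) 0 0 = M 0 0 + N 0 0 by rewrite mxE.
by rewrite !addE [(y^T *m x) 0 0]dotC; ring.
Qed.

(** Expanding the square of the norm of [|y| x - |x| y] gives [2 |x| |y| (|x| |y| - x.y) >= 0]; the
    factor [|x| |y|] is positive once the zero vectors are set aside. *)
Lemma cauchy_schwarz q (x y : 'cV[R]_q) :
  (x^T *m y) 0 0 <= enorm x * enorm y.
Proof.
have [x0|xn0] := eqVneq (enorm x) 0.
  by rewrite x0 (enorm_eq0 x0) trmx0 mul0mx mxE mul0r.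
have [y0|yn0] := eqVneq (enorm y) 0.
  by rewrite y0 (enorm_eq0 y0) mulmx0 mxE mulr0.
have xp : 0 < enorm x by rewrite lt_neqAle eq_sym xn0 enorm_ge0.
have yp : 0 < enorm y by rewrite lt_neqAle eq_sym yn0 enorm_ge0.
have := sqr_ge0 (enorm (enorm y *: x + (- enorm x) *: y)).
rewrite enorm_sqrD !enormZ normrN !ger0_norm ?enorm_ge0 //.
rewrite [(_ *: _)^T]linearZ /= -scalemxAl -scalemxAr !mxE => h.
have xy := mulr_gt0 xp yp.
set d := (\sum_j _) in h *.
suff : 0 <= (enorm x * enorm y) * (enorm x * enorm y - d).
  by rewrite pmulr_rge0 // subr_ge0.
set a := enorm x in h *; set b := enorm y in h *.
have -> : a * b * (a * b - d) = ((b * a) ^+ 2 + 2 * (b * (- a * d)) + (a * b) ^+ 2) / 2.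
  by field.
by rewrite divr_ge0.
Qed.

Lemma enormD q (x y : 'cV[R]_q) : enorm (x + y) <= enorm x + enorm y.
Proof.
rewrite -(@ler_pXn2r _ 2) // ?nnegrE ?addr_ge0 ?enorm_ge0 // enorm_sqrD.
have := cauchy_schwarz x y.
by rewrite sqrrD [_ * _ *+ 2]mulr2n; lra.
Qed.

(** * The operator norm as a supremum *)

(** A supremum over an unbounded set is only a default value, so boundedness comes before any use of
    [opnorm]. Cauchy-Schwarz against each row bounds each coordinate of [M *m x]. *)
Lemma opnorm_has_ubound p q (M : 'M[R]_(p, q)) :
  has_ubound [set y : R | exists x : 'cV[R]_q, enorm x = 1 /\ y = enorm (M *m x)]%classic.
Proof.
(* the Frobenius norm *)
exists (Num.sqrt (\sum_i enorm (row i M)^T ^+ 2)) => _ [x [x1 ->]].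
apply: ler_wsqrtr; apply: ler_sum => i _.
have -> : (M *m x) i 0 = ((row i M)^T^T *m x) 0 0.
  by rewrite trmxK -row_mul [RHS]mxE.
have c1 := cauchy_schwarz (row i M)^T x.
have := cauchy_schwarz (- (row i M)^T) x.
rewrite [(- _)^T]linearN mulNmx mxE enormN x1 !mulr1 => c2; rewrite x1 mulr1 in c1.
rewrite -[leLHS]real_normK ?num_real // ler_pXn2r ?nnegrE ?enorm_ge0 //.
by rewrite ler_norml c1 lerNl c2.
Qed.

Lemma opnorm_mul p q (M : 'M[R]_(p, q)) (x : 'cV[R]_q) :
  enorm (M *m x) <= opnorm M * enorm x.
Proof.
have [x0|xn0] := eqVneq (enorm x) 0.
  by rewrite (enorm_eq0 x0) mulmx0 !enorm0 mulr0.
have xp : 0 < enorm x by rewrite lt_neqAle eq_sym xn0 enorm_ge0.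
rewrite -ler_pdivrMr //.
have -> : enorm (M *m x) / enorm x = enorm (M *m ((enorm x)^-1 *: x)).
  by rewrite -scalemxAr enormZ ger0_norm ?invr_ge0 ?enorm_ge0 // mulrC.
apply: ub_le_sup; first exact: opnorm_has_ubound.
exists ((enorm x)^-1 *: x); split => //.
by rewrite enormZ ger0_norm ?invr_ge0 ?enorm_ge0 // mulVf.
Qed.

Lemma opnorm_le p q (M : 'M[R]_(p, q)) (b : R) : 0 <= b ->
  (forall x, enorm x = 1 -> enorm (M *m x) <= b) -> opnorm M <= b.
Proof.
move=> b0 h; rewrite /opnorm.
case: (pselect (exists x : 'cV[R]_q, enorm x = 1)) => [[x x1]|nx].
  apply: ge_sup; first by exists (enorm (M *m x)), x.
  by move=> _ [y [y1 ->]]; exact: h.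
(* Without unit vectors, that is in dimension 0, the supremum is over the empty set and equals 0;
   hence the assumption [0 <= b]. *)
rewrite (_ : [set _ | _]%classic = set0) ?sup0 //.
by apply/seteqP; split => [y [x [x1 _]]|y []]; apply: nx; exists x.
Qed.

Lemma opnorm_ge0 p q (M : 'M[R]_(p, q)) : 0 <= opnorm M.
Proof.
rewrite /opnorm.
case: (pselect (exists x : 'cV[R]_q, enorm x = 1)) => [[x x1]|nx].
  apply: le_trans (enorm_ge0 (M *m x)) _.
  by apply: ub_le_sup; [exact: opnorm_has_ubound|exists x].
rewrite (_ : [set _ | _]%classic = set0) ?sup0 //.
by apply/seteqP; split => [y [x [x1 _]]|y []]; apply: nx; exists x.
Qed.

(** With [z = M^T y], Cauchy-Schwarz gives [|z|^2 = y.(M z) <= |y| b |z|], and [|z|] cancels. *)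
Lemma enorm_tr_mul p q (M : 'M[R]_(p, q)) (b : R) : 0 <= b ->
  (forall x, enorm (M *m x) <= b * enorm x) ->
  forall y, enorm (M^T *m y) <= b * enorm y.
Proof.
move=> b0 h y; set z := M^T *m y.
have [->|zn0] := eqVneq (enorm z) 0; first by rewrite mulr_ge0 ?enorm_ge0.
have zp : 0 < enorm z by rewrite lt_neqAle eq_sym zn0 enorm_ge0.
rewrite -(ler_pM2r zp) -expr2 enorm_sqr {1}/z trmx_mul trmxK -mulmxA.
apply: le_trans (cauchy_schwarz _ _) _.
by rewrite mulrAC mulrC; apply: ler_wpM2r; [exact: enorm_ge0|exact: h].
Qed.

Lemma opnorm_tr p q (M : 'M[R]_(p, q)) : opnorm M^T = opnorm M.
Proof.
suff le a b (N : 'M[R]_(a, b)) : opnorm N^T <= opnorm N.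
  by apply/le_anti; rewrite le -{1}[M]trmxK le.
apply: opnorm_le => [|x x1]; first exact: opnorm_ge0.
rewrite -[opnorm N]mulr1 -x1; apply: enorm_tr_mul; first exact: opnorm_ge0.
exact: opnorm_mul.
Qed.

Lemma opnormN p q (M : 'M[R]_(p, q)) : opnorm (- M) = opnorm M.
Proof.
suff le (N : 'M[R]_(p, q)) : opnorm (- N) <= opnorm N.
  by apply/le_anti; rewrite le -{1}[M]opprK le.
apply: opnorm_le => [|x x1]; first exact: opnorm_ge0.
by rewrite mulNmx enormN -[opnorm N]mulr1 -x1 opnorm_mul.
Qed.

(** * Isometries and complementary projections *)

Lemma enorm_isometry p q (M : 'M[R]_(p, q)) (x : 'cV[R]_q) :
  M^T *m M = 1%:M -> enorm (M *m x) = enorm x.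
Proof.
move=> MM; apply: enorm_eq.
by rewrite !enorm_sqr trmx_mul -mulmxA (mulmxA M^T) MM mul1mx.
Qed.

Lemma opnorm_mulr_isometry p q t (M : 'M[R]_(p, q)) (N : 'M[R]_(q, t)) :
  N^T *m N = 1%:M -> opnorm (M *m N) <= opnorm M.
Proof.
move=> NN; apply: opnorm_le => [|x x1]; first exact: opnorm_ge0.
rewrite -mulmxA; apply: le_trans (opnorm_mul _ _) _.
by rewrite enorm_isometry // x1 mulr1.
Qed.

(** Pythagoras: [y] is the sum of its projection [z] and of [X X^T y], which are orthogonal because
    [X^T z = 0], and [X] preserves norms. *)
Lemma enorm_proj p q (X : 'M[R]_(p, q)) (y : 'cV[R]_p) :
  X^T *m X = 1%:M ->
  enorm ((1%:M - X *m X^T) *m y) ^+ 2 = enorm y ^+ 2 - enorm (X^T *m y) ^+ 2.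
Proof.
move=> XX; set z := (1%:M - X *m X^T) *m y.
have yE : y = z + X *m (X^T *m y).
  by rewrite /z mulmxBl mul1mx !mulmxA subrK.
have Xz : X^T *m z = 0.
  by rewrite /z mulmxBl mul1mx mulmxBr !mulmxA XX mul1mx subrr.
have zX : z^T *m X = 0 by rewrite -[LHS]trmxK trmx_mul trmxK Xz trmx0.
rewrite {1}yE enorm_sqrD mulmxA zX mul0mx [(0 : 'M_1) 0 0]mxE mulr0 addr0.
by rewrite (enorm_isometry _ XX) addrK.
Qed.

Lemma enorm_proj_le p q (X : 'M[R]_(p, q)) (y : 'cV[R]_p) :
  X^T *m X = 1%:M -> enorm ((1%:M - X *m X^T) *m y) <= enorm y.
Proof.
move=> XX; apply: enorm_le_sqr; rewrite enorm_proj //.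
by have := sqr_ge0 (enorm (X^T *m y)); lra.
Qed.

End Euclidean.

(** * Existence of singular value decompositions *)

Section SVD.
Set Implicit Arguments.
Unset Strict Implicit.
Context {R : realType}.

Lemma ler_norm_enorm q (x : 'cV[R]_q) i : `|x i 0| <= enorm x.
Proof.
rewrite -(@ler_pXn2r _ 2) ?nnegrE ?normr_ge0 ?enorm_ge0 // real_normK ?num_real //.
by rewrite enorm_sqr_sum (bigD1 i) //= lerDl sumr_ge0 // => j _; exact: sqr_ge0.
Qed.

Lemma enorm_delta q (i : 'I_q) : enorm (delta_mx i 0 : 'cV[R]_q) = 1.
Proof.
apply/eqP; rewrite -(@eqrXn2 _ 2) ?enorm_ge0 // enorm_sqr_sum expr1n.
rewrite (bigD1 i) //= big1 => [|j ji]; rewrite !mxE ?eqxx ?addr0 ?expr1n //.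
by rewrite (negPf ji) expr0n.
Qed.

Lemma enorm_col_mx p q (x : 'cV[R]_p) (y : 'cV[R]_q) :
  enorm (col_mx x y) ^+ 2 = enorm x ^+ 2 + enorm y ^+ 2.
Proof. by rewrite !enorm_sqr tr_col_mx mul_row_col mxE. Qed.

(** * Maximizing the norm over the unit sphere *)

(** Squaring turns the norm into a polynomial in the coordinates. Row vectors are used because the
    extreme value theorem applied later is stated for them. *)
Lemma continuous_mul_sqr p q (M : 'M[R]_(p, q)) :
  continuous (fun x : 'rV[R]_q => enorm (M *m x^T) ^+ 2 : R).
Proof.
have -> : (fun x : 'rV[R]_q => enorm (M *m x^T) ^+ 2) =
    fun x => \sum_i (fun x => (\sum_j M i j * x 0 j) * (\sum_j M i j * x 0 j)) x.
  apply/funext => x; rewrite enorm_sqr_sum; apply: eq_bigr => i _.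
  by rewrite mxE expr2; congr (_ * _); apply: eq_bigr => j _; rewrite mxE.
apply: (continuous_big (@add_continuous R)) => i _.
have c : continuous (fun x : 'rV[R]_q => \sum_j M i j * x 0 j).
  apply: (continuous_big (@add_continuous R)) => j _ x.
  by apply: (@continuousM _ _ (fun=> M i j)); [exact: cst_continuous|exact: coord_continuous].
by move=> x; apply: continuousM; exact: c.
Qed.

(** The sphere is bounded, as coordinates are at most the Euclidean norm, and closed, as the
    preimage of 1 under the continuous squared norm. *)
Lemma compact_sphere q : compact [set x : 'rV[R]_q | enorm x^T = 1]%classic.
Proof.
apply: bounded_closed_compact.
  exists 1; split => [|M M1 x /= x1]; first exact: num_real.
  apply: le_trans (ltW M1); rewrite /Num.norm /= mx_normrE.
  apply: bigmax_le => // -[i j] _ /=; rewrite ord1 -x1.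
  by have := ler_norm_enorm x^T j; rewrite mxE.
rewrite (_ : [set x | _]%classic =
   ((fun x : 'rV[R]_q => enorm (1%:M *m x^T) ^+ 2 : R) @^-1` [set 1 : R])%classic).
  apply: closed_comp; last exact: closed_eq.
  by move=> x _; exact: continuous_mul_sqr.
apply/seteqP; split => x /=; rewrite mul1mx; first by move=> x1; rewrite x1 expr1n.
move=> /eqP; rewrite -[X in _ == X](expr1n _ 2) eqrXn2 ?enorm_ge0 ?ler01 //.
by move=> /eqP.
Qed.

Lemma exists_max_vector p q (M : 'M[R]_(p, q.+1)) :
  exists v, enorm v = 1 /\ forall x, enorm (M *m x) <= enorm (M *m v) * enorm x.
Proof.
have ne : ([set x : 'rV[R]_q.+1 | enorm x^T = 1] !=set0)%classic.
  by exists (delta_mx 0 0); rewrite /= trmx_delta enorm_delta.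
have [c] := EVT_max_rV ne (@compact_sphere _)
  (continuous_subspaceT (@continuous_mul_sqr _ _ M)).
rewrite inE /= => c1 cmax; exists c^T; split => // x.
have [x0|xn0] := eqVneq (enorm x) 0.
  by rewrite (enorm_eq0 x0) mulmx0 !enorm0 mulr0.
have xp : 0 < enorm x by rewrite lt_neqAle eq_sym xn0 enorm_ge0.
have n1 : enorm ((enorm x)^-1 *: x) = 1.
  by rewrite enormZ ger0_norm ?invr_ge0 ?enorm_ge0 // mulVf.
have := cmax ((enorm x)^-1 *: x)^T; rewrite inE /= trmxK => /(_ n1).
move/enorm_le_sqr; rewrite -scalemxAr enormZ ger0_norm ?invr_ge0 ?enorm_ge0 //.
by rewrite mulrC ler_pdivrMr.
Qed.

(** Applied to the first basis vector and a unit vector [y], this completes [y] to an orthonormal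
    basis, namely the columns of [P]. *)
Lemma exists_orthogonal q (x y : 'cV[R]_q) : enorm x = enorm y ->
  exists P : 'M[R]_q, P^T *m P = 1%:M /\ P *m x = y.
Proof.
move=> xy; set w := y - x.
have [w0|wn0] := eqVneq (enorm w) 0.
  exists 1%:M; rewrite trmx1 !mul1mx; split => //.
  by move/enorm_eq0/eqP: w0; rewrite subr_eq0 => /eqP.
have ww : w^T *m w = (enorm w ^+ 2)%:M by rewrite enorm_sqr -mx11_scalar.
set a := 2 / enorm w ^+ 2.
(* Householder reflection in the hyperplane orthogonal to [y - x] *)
exists (1%:M - a *: (w *m w^T)); split.
  rewrite [_^T]linearB /= [(a *: _)^T]linearZ /= trmx1 trmx_mul trmxK.
  rewrite mulmxBl mul1mx -scalemxAl mulmxBr mulmx1 -scalemxAr.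
  rewrite -mulmxA (mulmxA w^T) ww mul_scalar_mx -scalemxAr scalerBr !scalerA.
  have -> : a * (a * enorm w ^+ 2) = a + a by rewrite /a; field.
  by rewrite scalerDl opprB addrK subrK.
(* Since [y = w + x] and [|x| = |y|], expanding [|w + x|^2] forces [w.x = - |w|^2 / 2]; the
   reflection then adds exactly [w] to [x]. *)
have wx : w^T *m x = (- (enorm w ^+ 2 / 2))%:M.
  rewrite [w^T *m x]mx11_scalar; congr (_%:M).
  have := enorm_sqrD w x; rewrite /w subrK -xy => h.
  by move: h; rewrite -/w; lra.
rewrite mulmxBl mul1mx -scalemxAl -mulmxA wx mul_mx_scalar scalerA.
have -> : a * - (enorm w ^+ 2 / 2) = -1 by rewrite /a; field.
by rewrite scaleN1r opprK /w addrC subrK.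
Qed.

(* Split off the top singular triple: if [v] maximizes [|M v|] on the unit
   sphere and [M v = s u], then in orthonormal bases starting with [u] and [v]
   the first row and column of [M] vanish off the corner, since [|M| = s]. *)
Lemma svd_exists p q (M : 'M[R]_(p, q)) : exists S U V, is_svd M U S V.
Proof.
have empty a b (N : 'M[R]_(a, b)) : ('I_a -> 'I_b -> False) ->
    exists S U V, is_svd N U S V.
  move=> no; exists 0, 1%:M, 1%:M.
  split => [|i j|i j|i i' j j'|]; try by case: (no i j).
    by rewrite !trmx1 !mul1mx.
  by apply/matrixP => i j; case: (no i j).
elim: p q M => [|p IH] [|q] M; try by apply: empty => i j; case: i; case: j.
(* Dimensions are retyped as [1 + p] and [1 + q] so that block matrices apply. *)
suff : exists S U V, @is_svd R (1 + p) (1 + q) M U S V by [].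
have [v [v1 vmax]] := exists_max_vector M.
set s := enorm (M *m v) in vmax.
have s0 : 0 <= s by exact: enorm_ge0.
(* If [s = 0] then [M v = 0] and any unit vector serves as [u]. *)
have [u [u1 Mv]] : exists u, enorm u = 1 /\ M *m v = s *: u.
  have [e|sn0] := eqVneq s 0.
    exists (delta_mx 0 0); rewrite enorm_delta e scale0r; split => //.
    exact: enorm_eq0.
  exists (s^-1 *: (M *m v)); rewrite enormZ scalerA mulfV // scale1r.
  by rewrite ger0_norm ?invr_ge0 // -/s mulVf.
pose e k : 'cV[R]_(1 + k) := col_mx 1%:M 0.
have e1 k : enorm (e k) = 1.
  have -> : e k = delta_mx 0 0; last exact: enorm_delta.
  apply/matrixP => i j; rewrite ord1; case: (split_ordP i) => l ->.
    by rewrite col_mxEu !mxE !ord1 eqxx.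
  by rewrite col_mxEd !mxE.
have [P [PP Pu]] : exists P : 'M[R]_(1 + p), P^T *m P = 1%:M /\ P *m e p = u.
  by apply: exists_orthogonal; rewrite e1 u1.
have [Q [QQ Qv]] : exists P : 'M[R]_(1 + q), P^T *m P = 1%:M /\ P *m e q = v.
  by apply: exists_orthogonal; rewrite e1 v1.
have PP' := mulmx1C PP; have QQ' := mulmx1C QQ.
pose N : 'M[R]_(1 + p, 1 + q) := P^T *m M *m Q.
have MN : M = P *m N *m Q^T.
  by rewrite /N !mulmxA PP' mul1mx -mulmxA QQ' mulmx1.
have Ne : N *m e q = s *: e p.
  by rewrite /N -mulmxA Qv -mulmxA Mv -scalemxAr -Pu mulmxA PP mul1mx.
have Nle x : enorm (N *m x) <= s * enorm x.
  rewrite /N -!mulmxA enorm_isometry ?trmxK //.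
  by apply: le_trans (vmax _) _; rewrite enorm_isometry.
have NE := submxK N.
move: Ne; rewrite -NE mul_block_col !mulmx1 !mulmx0 !addr0 scale_col_mx.
move=> /eq_col_mx[]; rewrite scaler0 => ul dl.
(* The transpose obeys the same bound [s], while the squared norm of [N^T] applied to the first
   basis vector is [s^2] plus that of [ursubmx N]; the latter must vanish. *)
have ur : ursubmx N = 0.
  have h := enorm_tr_mul s0 Nle (e p); rewrite e1 mulr1 -NE in h.
  rewrite tr_block_mx mul_block_col !mulmx1 !mulmx0 !addr0 ul in h.
  have : enorm (ursubmx N)^T = 0.
    apply/eqP; rewrite -sqrf_eq0 eq_le sqr_ge0 andbT.
    rewrite -(@ler_pXn2r _ 2) ?nnegrE ?enorm_ge0 // in h.
    move: h; rewrite enorm_col_mx [(s *: _)^T]linearZ /= enormZ trmx1.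
    have -> : enorm (1%:M : 'cV[R]_1) = 1.
      by rewrite (_ : 1%:M = delta_mx 0 0) ?enorm_delta //;
        apply/matrixP => i j; rewrite !ord1 !mxE.
    by rewrite mulr1 ger0_norm //; lra.
  by move=> /enorm_eq0 /(congr1 trmx); rewrite trmxK trmx0 => ->.
set N' := drsubmx N in NE.
rewrite ul ur dl in NE.
have N'le x : enorm (N' *m x) <= s * enorm x.
  have := Nle (col_mx 0 x); rewrite -NE mul_block_col !mul0mx !mulmx0 !add0r.
  have nE k (z : 'cV[R]_k) : enorm (col_mx (0 : 'cV_1) z) = enorm z.
    by apply: enorm_eq; rewrite enorm_col_mx enorm0 expr0n add0r.
  by rewrite !nE.
have [S' [U' [V' [[UU VV] Soff Sge Sdec N'E]]]] := IH _ N'.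
(* This keeps the diagonal nonincreasing when [s] is put in front of [S']: an entry of [S'] is at
   most the norm of its column, and [S'] inherits the bound of [N']. *)
have S'le i j : S' i j <= s.
  have S'E : S' = U'^T *m (N' *m V').
    by rewrite N'E -!mulmxA VV mulmx1 mulmxA UU mul1mx.
  have -> : S' i j = (S' *m delta_mx j 0 : 'cV_p) i 0 by rewrite -colE mxE.
  apply: le_trans (ler_norm _) _; apply: le_trans (ler_norm_enorm _ _) _.
  rewrite S'E -!mulmxA enorm_isometry ?trmxK ?(mulmx1C UU) //.
  apply: le_trans (N'le _) _.
  by rewrite enorm_isometry // enorm_delta mulr1.
exists (block_mx (s%:M : 'M_1) 0 0 S'),
  (P *m block_mx (1%:M : 'M_1) 0 0 U'), (Q *m block_mx (1%:M : 'M_1) 0 0 V').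
split.
- split; rewrite trmx_mul -mulmxA.
    by rewrite (mulmxA P^T) PP mul1mx tr_block_mx mulmx_block trmx1 !trmx0
      !mul0mx !mulmx0 mul1mx !addr0 add0r UU -scalar_mx_block.
  by rewrite (mulmxA Q^T) QQ mul1mx tr_block_mx mulmx_block trmx1 !trmx0
      !mul0mx !mulmx0 mul1mx !addr0 add0r VV -scalar_mx_block.
- move=> i j; case: (split_ordP i) => a ->; case: (split_ordP j) => b ->.
  + by rewrite !ord1.
  + by rewrite block_mxEur mxE.
  + by rewrite block_mxEdl mxE.
  + by rewrite block_mxEdr /= eqn_add2l; exact: Soff.
- move=> i j; case: (split_ordP i) => a ->; case: (split_ordP j) => b ->.
  + by rewrite block_mxEul !ord1 mxE.
  + by rewrite block_mxEur mxE.
  + by rewrite block_mxEdl mxE.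
  + by rewrite block_mxEdr /= => /addnI; exact: Sge.
- move=> i i' j j'; case: (split_ordP i) => a ->; case: (split_ordP j) => b ->;
  case: (split_ordP i') => a' ->; case: (split_ordP j') => b' ->;
  rewrite ?block_mxEul ?block_mxEur ?block_mxEdl ?block_mxEdr /= //.
  all: try by rewrite !ord1 !mxE.
  + by move=> /addnI ab /addnI ab'; rewrite leq_add2l; exact: Sdec.
- rewrite MN -NE trmx_mul !mulmxA; congr (_ *m _); rewrite -!mulmxA; congr (_ *m _).
  rewrite tr_block_mx !mulmx_block trmx1 !trmx0 !mul0mx !mulmx0 mul1mx mulmx1 !addr0 !add0r.
  by rewrite !mulmx0 scalemx1 N'E mulmxA.
Qed.

End SVD.

(** * Singular subspaces and canonical angles *)

Section SinTheta.
Set Implicit Arguments.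
Unset Strict Implicit.
Context {R : realType}.

Lemma svE p q (S : 'M[R]_(p, q)) (i : 'I_p) (j : 'I_q) :
  (i : nat) = j -> sv S i.+1 = S i j.
Proof.
move=> ij; rewrite /sv; case: pickP => [[a b] /= /andP[/eqP ai /eqP bi]|/(_ (i, j))] /=.
  have -> : a = i by exact: val_inj.
  have -> // : b = j by apply: val_inj; rewrite /= bi ij.
by rewrite ij !eqxx.
Qed.

Lemma sv_tr p q (S : 'M[R]_(p, q)) k : sv S^T k = sv S k.
Proof.
rewrite {1}/sv; case: pickP => [[a b] /= /and3P[k0 /eqP ak /eqP bk]|no].
  by rewrite mxE -(prednK k0) -bk; apply/esym/svE; rewrite ak bk.
rewrite /sv; case: pickP => [[a b] /= h|//].
by have := no (b, a); rewrite /= andbA andbAC -andbA h.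
Qed.

Lemma is_svd_tr p q (M : 'M[R]_(p, q)) U S V :
  is_svd M U S V -> is_svd M^T V S^T U.
Proof.
move=> [[UU VV] off ge dec ->]; split => //.
- by move=> i j ij; rewrite mxE; apply: off; rewrite eq_sym.
- by move=> i j ij; rewrite mxE; apply: ge.
- move=> i i' j j' ij ij' ii'; rewrite !mxE; apply: dec => //.
  by rewrite -ij -ij'.
- by rewrite !trmx_mul trmxK mulmxA.
Qed.

(** Writing the selection of columns as a product with a truncated identity reduces what follows to
    matrix algebra. *)
Lemma leadcolsE p r (U : 'M[R]_p) : leadcols r U = U *m pid_mx r.
Proof.
apply/matrixP => i j; rewrite !mxE big_mkcond /=; apply: eq_bigr => l _.
rewrite mxE; case: eqP => [->|_]; last by rewrite mulr0.
by rewrite ltn_ord mulr1.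
Qed.

Lemma leadcols_isometry p r (U : 'M[R]_p) : (r <= p)%N ->
  U^T *m U = 1%:M -> (leadcols r U)^T *m leadcols r U = 1%:M.
Proof.
move=> rp UU; rewrite leadcolsE trmx_mul -mulmxA (mulmxA U^T) UU mul1mx.
by rewrite tr_pid_mx mul_pid_mx minnn (minn_idPr rp) pid_mx_1.
Qed.

(** These are the equations [M v_j = sigma_j u_j] for the leading [r] indices, gathered into one;
    they hold because [S] and the diagonal commute with truncation. *)
Lemma svd_mul_leadcols p q r (M : 'M[R]_(p, q)) U S V : (r <= p)%N -> (r <= q)%N ->
  is_svd M U S V ->
  M *m leadcols r V = leadcols r U *m diag_mx (\row_j sv S j.+1).
Proof.
move=> rp rq [[UU VV] off _ _ ->]; rewrite !leadcolsE -!mulmxA; congr (_ *m _).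
rewrite (mulmxA V^T) VV mul1mx; apply/matrixP => i j.
rewrite mul_mx_diag !mxE (bigD1 (widen_ord rq j)) //= big1 => [|l lj]; last first.
  by rewrite mxE -(inj_eq val_inj) /= in lj *; rewrite (negPf lj) mulr0.
rewrite addr0 mxE /= eqxx ltn_ord mulr1.
case: eqP => [ij|/eqP ij]; last by rewrite mul0r off.
by rewrite ij ltn_ord mul1r -ij (@svE _ _ _ _ (widen_ord rq j)).
Qed.

Lemma sv_ge0 p q (M : 'M[R]_(p, q)) U S V k : is_svd M U S V -> 0 <= sv S k.
Proof.
move=> [_ _ ge _ _]; rewrite /sv; case: pickP => [[a b] /=|//].
by move=> /and3P[_ /eqP ak /eqP bk]; apply: ge; rewrite ak bk.
Qed.

(** In the coordinates [z = V^T y] the first [r] entries vanish, and [S] scales each remaining one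
    by at most its diagonal entry of index [r.+1], counted from 1. *)
Lemma enorm_svd_tail p q r (M : 'M[R]_(p, q)) U S V (y : 'cV[R]_q) :
  (r < p)%N -> (r < q)%N -> is_svd M U S V ->
  (leadcols r V)^T *m y = 0 -> enorm (M *m y) <= sv S r.+1 * enorm y.
Proof.
move=> rp rq svdM; have s0 := sv_ge0 r.+1 svdM.
case: svdM => [[UU VV] off ge dec ->] y0.
have VV' : V^T^T *m V^T = 1%:M by rewrite trmxK (mulmx1C VV).
rewrite -!mulmxA enorm_isometry // -(enorm_isometry y VV').
set z := V^T *m y.
have z0 (j : 'I_q) : (j < r)%N -> z j 0 = 0.
  move=> jr; have : ((leadcols r V)^T *m y) (Ordinal jr) 0 = 0 by rewrite y0 mxE.
  rewrite leadcolsE trmx_mul -mulmxA -/z tr_pid_mx mxE (bigD1 j) //= big1 => [|l lj].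
    by rewrite mxE /= eqxx jr mul1r addr0.
  by rewrite mxE -(inj_eq val_inj) /= eq_sym in lj *; rewrite (negPf lj) mul0r.
rewrite -(@ler_pXn2r _ 2) ?nnegrE ?mulr_ge0 ?enorm_ge0 // exprMn !enorm_sqr_sum.
(* each row of [S] has at most one nonzero entry *)
have row_sqr i : (S *m z) i 0 ^+ 2 = \sum_j S i j ^+ 2 * z j 0 ^+ 2.
  rewrite mxE; have [iq|qi] := ltnP i q.
    rewrite (bigD1 (Ordinal iq)) //= big1 => [|j ji].
      rewrite [RHS](bigD1 (Ordinal iq)) //= [X in _ = _ + X]big1 => [|j ji].
        by rewrite !addr0 exprMn.
      by rewrite off ?expr0n ?mul0r // eq_sym.
    by rewrite off ?mul0r // eq_sym.
  have ij (j : 'I_q) : (i : nat) != j by rewrite neq_ltn (leq_trans (ltn_ord j) qi) orbT.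
  by rewrite !big1 ?expr0n // => j _; rewrite off ?ij ?expr0n ?mul0r.
under eq_bigr do rewrite row_sqr.
rewrite exchange_big mulr_sumr; apply: ler_sum => j _.
rewrite -mulr_suml.
have [jr|rj] := ltnP j r; first by rewrite z0 // expr0n /= !mulr0.
apply: ler_wpM2r; first exact: sqr_ge0.
have [jp|pj] := ltnP j p.
  rewrite (bigD1 (Ordinal jp)) //= big1 => [|i ij]; last first.
    by rewrite off ?expr0n //.
  rewrite addr0 ler_pXn2r ?nnegrE // ?ge //.
  by rewrite (@svE _ _ _ (Ordinal rp) (Ordinal rq)) //; exact: dec.
(* A column of index [p] or more meets no diagonal position, so it is zero. *)
rewrite big1 ?sqr_ge0 // => i _; rewrite off ?expr0n //.
by rewrite neq_ltn (leq_trans (ltn_ord i) pj).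
Qed.

Lemma enorm_svd_col p q (M : 'M[R]_(p, q)) U S V (i : 'I_p) (j : 'I_q) :
  is_svd M U S V -> (i : nat) = j -> enorm (M *m (V *m delta_mx j 0)) = sv S i.+1.
Proof.
move=> svdM ij; have s0 := sv_ge0 i.+1 svdM.
case: svdM => [[UU VV] off _ _ ->].
rewrite -!mulmxA (mulmxA V^T) VV mul1mx enorm_isometry //.
apply/eqP; rewrite -(@eqrXn2 _ 2) ?enorm_ge0 // enorm_sqr_sum (svE _ ij).
rewrite (bigD1 i) //= -colE mxE big1 ?addr0 // => l li.
by rewrite mxE off ?expr0n // -ij (inj_eq val_inj).
Qed.

Lemma enorm_diag_le q (d : 'rV[R]_q) (b : R) (x : 'cV[R]_q) : 0 <= b ->
  (forall i, `|d 0 i| <= b) -> enorm (diag_mx d *m x) <= b * enorm x.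
Proof.
move=> b0 db; rewrite -(@ler_pXn2r _ 2) ?nnegrE ?mulr_ge0 ?enorm_ge0 //.
rewrite exprMn !enorm_sqr_sum mulr_sumr; apply: ler_sum => i _.
rewrite mul_diag_mx mxE exprMn; apply: ler_wpM2r; first exact: sqr_ge0.
by rewrite -[leLHS]real_normK ?num_real // ler_pXn2r ?nnegrE.
Qed.

(** * Canonical angles and projections *)

(** [sval] reads a diagonal picked by [epsilon]; the existence theorem guarantees that this pick
    comes from a genuine decomposition. *)
Lemma sval_svd p q (M : 'M[R]_(p, q)) :
  exists S U V, is_svd M U S V /\ forall k, Defs.sval M k = sv S k.
Proof.
have [U [V h]] := epsilon_spec (inhabits (0 : 'M[R]_(p, q)))
  (fun S => exists U V, is_svd M U S V) (svd_exists M).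
by do 3 eexists; split; [exact: h|].
Qed.

(** Each diagonal entry is the norm of a projected unit vector, obtained from a right singular
    vector of [X^T Y] in the first alternative and from a left one in the second. Having both
    alternatives lets the two perturbation bounds enter the same minimum. *)
Lemma opnorm_sinTheta_le d r (X Y : 'M[R]_(d, r)) (b : R) :
  X^T *m X = 1%:M -> Y^T *m Y = 1%:M -> 0 <= b ->
  (forall x, enorm x = 1 -> enorm ((1%:M - X *m X^T) *m (Y *m x)) <= b) \/
  (forall x, enorm x = 1 -> enorm ((1%:M - Y *m Y^T) *m (X *m x)) <= b) ->
  opnorm (sinTheta X Y) <= b.
Proof.
move=> XX YY b0 h; have [S [U [V [svdC svC]]]] := sval_svd (X^T *m Y).
have -> : sinTheta X Y =
    diag_mx (\row_i Num.sqrt (1 - Defs.sval (X^T *m Y) i.+1 ^+ 2)).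
  apply/matrixP => i j; rewrite !mxE; case: eqP => [->|_].
    by rewrite mulr1n.
  by rewrite mulr0n.
apply: opnorm_le => // x x1.
apply: le_trans (enorm_diag_le _ b0 _) _; last by rewrite x1 mulr1.
move=> i; rewrite mxE ger0_norm ?sqrtr_ge0 // svC.
rewrite -[b]ger0_norm // -sqrtr_sqr; apply: ler_wsqrtr.
have [[UU VV] _ _ _ _] := svdC.
have e1 (W : 'M[R]_r) : W^T *m W = 1%:M -> enorm (W *m delta_mx i 0) = 1.
  by move=> WW; rewrite enorm_isometry // enorm_delta.
case: h => h.
  have <- : enorm ((1%:M - X *m X^T) *m (Y *m (V *m delta_mx i 0))) ^+ 2 =
      1 - sv S i.+1 ^+ 2.
    rewrite enorm_proj // (enorm_isometry _ YY) e1 // expr1n.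
    by rewrite (mulmxA X^T) (enorm_svd_col svdC (erefl (i : nat))).
  by rewrite ler_pXn2r ?nnegrE ?enorm_ge0 // h // e1.
have <- : enorm ((1%:M - Y *m Y^T) *m (X *m (U *m delta_mx i 0))) ^+ 2 =
    1 - sv S i.+1 ^+ 2.
  rewrite enorm_proj // (enorm_isometry _ XX) e1 // expr1n (mulmxA Y^T).
  have := enorm_svd_col (is_svd_tr svdC) (erefl (i : nat)).
  by rewrite sv_tr trmx_mul trmxK => ->.
by rewrite ler_pXn2r ?nnegrE ?enorm_ge0 // h // e1.
Qed.

(** * Perturbation bounds *)

(** Factor [Z] as [(Z D) D^-1], where [D^-1] has norm at most [1 / t]. *)
Lemma opnorm_mul_diag p q (Z : 'M[R]_(p, q)) (d : 'rV[R]_q) (t c : R) :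
  0 < t -> 0 <= c -> (forall j, t <= d 0 j) ->
  (forall x, enorm (Z *m diag_mx d *m x) <= c * enorm x) -> t * opnorm Z <= c.
Proof.
move=> t0 c0 td h; rewrite mulrC -ler_pdivlMr //.
apply: opnorm_le => [|x x1]; first by rewrite divr_ge0 // ltW.
have d0 j : 0 < d 0 j by exact: lt_le_trans t0 (td j).
have -> : Z *m x = Z *m diag_mx d *m (diag_mx (\row_j (d 0 j)^-1) *m x).
  rewrite !mulmxA -(mulmxA Z) mulmx_diag (_ : \row_j _ = const_mx 1).
    by rewrite diag_const_mx mulmx1.
  by apply/rowP => j; rewrite !mxE mulfV // gt_eqF.
apply: le_trans (h _) _; apply: ler_wpM2l => //.
rewrite -[t^-1]mulr1 -x1; apply: enorm_diag_le => [|j].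
  by rewrite invr_ge0 ltW.
by rewrite mxE ger0_norm ?lef_pV2 ?posrE ?invr_ge0 ?(ltW (d0 j)).
Qed.

Lemma svd_proj_bound n m r (A dA : 'M[R]_(n, m)) U S V Ut St Vt :
  (0 < r)%N -> (r < n)%N -> (r < m)%N ->
  is_svd A U S V -> is_svd (A + dA) Ut St Vt ->
  sv S r.+1 < sv St r ->
  opnorm ((1%:M - leadcols r U *m (leadcols r U)^T) *m leadcols r Ut) <=
  (sv St r * opnorm (dA *m leadcols r Vt) +
   sv S r.+1 * opnorm (dA^T *m leadcols r Ut)) /
  (sv St r ^+ 2 - sv S r.+1 ^+ 2).
Proof.
move=> r0 rn rm svdA svdB gap.
have s0 := sv_ge0 r.+1 svdA; have t0 := le_lt_trans s0 gap.
set U1 := leadcols r U; set V1 := leadcols r V.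
set Ut1 := leadcols r Ut; set Vt1 := leadcols r Vt.
have AV : A *m V1 = U1 *m _ := svd_mul_leadcols (ltnW rn) (ltnW rm) svdA.
have AU : A^T *m U1 = V1 *m _ := svd_mul_leadcols (ltnW rm) (ltnW rn) (is_svd_tr svdA).
have BV : (A + dA) *m Vt1 = Ut1 *m _ := svd_mul_leadcols (ltnW rn) (ltnW rm) svdB.
have BU : (A + dA)^T *m Ut1 = Vt1 *m _ :=
  svd_mul_leadcols (ltnW rm) (ltnW rn) (is_svd_tr svdB).
have rowtr p q (T : 'M[R]_(p, q)) : \row_(j < r) sv T^T j.+1 = \row_j sv T j.+1.
  by apply/rowP => j; rewrite !mxE sv_tr.
rewrite rowtr in AU; rewrite rowtr in BU.
set D := diag_mx _ in AV AU; set Dt := diag_mx _ in BV BU.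
have [[UU VV] _ _ _ _] := svdA.
have U1U1 : U1^T *m U1 = 1%:M := leadcols_isometry (ltnW rn) UU.
have V1V1 : V1^T *m V1 = 1%:M := leadcols_isometry (ltnW rm) VV.
set P := 1%:M - U1 *m U1^T; pose Q := 1%:M - V1 *m V1^T.
(* Both [U1 U1^T A] and [A V1 V1^T] equal [U1 D V1^T]. *)
have PA : P *m A = A *m Q.
  rewrite mulmxBl mul1mx mulmxBr mulmx1; congr (_ - _).
  rewrite mulmxA AV -!mulmxA; congr (_ *m _).
  by rewrite -[LHS]trmxK trmx_mul trmxK AU trmx_mul tr_diag_mx.
have PT : P^T = P by rewrite [LHS]linearB /= trmx1 trmx_mul trmxK.
have QT : Q^T = Q by rewrite [LHS]linearB /= trmx1 trmx_mul trmxK.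
have QA : Q *m A^T = A^T *m P by rewrite -[Q]QT -[P]PT -!trmx_mul PA.
have V1Q : V1^T *m Q = 0 by rewrite mulmxBr mulmx1 mulmxA V1V1 mul1mx subrr.
have U1P : U1^T *m P = 0 by rewrite mulmxBr mulmx1 mulmxA U1U1 mul1mx subrr.
set Z := P *m Ut1; pose W := Q *m Vt1.
have ZD : Z *m Dt = A *m W + P *m (dA *m Vt1).
  by rewrite /Z /W -mulmxA -BV (mulmxDl A) (mulmxDr P) !mulmxA PA.
have WD : W *m Dt = A^T *m Z + Q *m (dA^T *m Ut1).
  by rewrite /Z /W -mulmxA -BU [(A + dA)^T]linearD /= (mulmxDl A^T) (mulmxDr Q) !mulmxA QA.
(* Diagonal entries decrease, so the last of the leading [r] is the least; in the 0-based matrix it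
   sits at position [r.-1]. *)
have td j : sv St r <= (\row_(j < r) sv St j.+1) 0 j.
  have [_ _ _ dec _] := svdB; rewrite mxE.
  have jr := ltn_ord j; have rn1 : (r.-1 < n)%N by rewrite prednK // ltnW.
  have rm1 : (r.-1 < m)%N by rewrite prednK // ltnW.
  have jn := ltn_trans jr rn; have jm := ltn_trans jr rm.
  rewrite -[X in sv _ X <= _](prednK r0).
  rewrite (@svE _ _ _ (Ordinal rn1) (Ordinal rm1)) //.
  rewrite (@svE _ _ _ (Ordinal jn) (Ordinal jm)) //.
  by apply: dec => //=; rewrite -ltnS prednK.
(* One estimate serves both equations: [M] is [A] or [A^T], and [N] is the projection [P] or [Q]. *)
have step p q (M : 'M[R]_(p, q)) (X : 'M[R]_(p, r)) (Y : 'M[R]_(q, r)) E (N : 'M[R]_p) :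
    (forall y, enorm (M *m (Y *m y)) <= sv S r.+1 * enorm (Y *m y)) ->
    (forall y, enorm (N *m y) <= enorm y) ->
    X *m Dt = M *m Y + N *m E ->
    sv St r * opnorm X <= sv S r.+1 * opnorm Y + opnorm E.
  move=> hM hN XD; apply: opnorm_mul_diag td _ => // [|x].
    by rewrite addr_ge0 ?mulr_ge0 ?opnorm_ge0.
  rewrite -/Dt XD mulmxDl -!mulmxA; apply: le_trans (enormD _ _) _.
  rewrite mulrDl; apply: lerD.
    by apply: le_trans (hM _) _; rewrite -mulrA ler_wpM2l // opnorm_mul.
  by apply: le_trans (hN _) _; rewrite opnorm_mul.
have hZ := step _ _ _ _ _ _ _ _ (fun y => enorm_proj_le y U1U1) ZD.
have hW := step _ _ _ _ _ _ _ _ (fun y => enorm_proj_le y V1V1) WD.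
have {}hZ : sv St r * opnorm Z <= sv S r.+1 * opnorm W + opnorm (dA *m Vt1).
  apply: hZ => y; apply: enorm_svd_tail rn rm svdA _.
  by rewrite -/V1 /W !mulmxA V1Q !mul0mx.
have {}hW : sv St r * opnorm W <= sv S r.+1 * opnorm Z + opnorm (dA^T *m Ut1).
  apply: hW => y; rewrite -(sv_tr S); apply: enorm_svd_tail rm rn (is_svd_tr svdA) _.
  by rewrite -/U1 /Z !mulmxA U1P !mul0mx.
have gap2 : 0 < sv St r ^+ 2 - sv S r.+1 ^+ 2.
  by rewrite subr_gt0 ltr_pXn2r ?nnegrE // ltW.
rewrite ler_pdivlMr //.
(* Adding [sv St r] times the bound for [Z] to [sv S r.+1] times the bound for [W] cancels the terms
   in [opnorm W]. *)
have := ler_wpM2l (ltW t0) hZ; have := ler_wpM2l s0 hW.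
lra.
Qed.

Lemma sinTheta_bounds n m r (A dA : 'M[R]_(n, m)) U S V Ut St Vt :
  (0 < r)%N -> (r < n)%N -> (r < m)%N ->
  is_svd A U S V -> is_svd (A + dA) Ut St Vt ->
  sv S r.+1 < sv St r -> sv St r.+1 < sv S r ->
  opnorm (sinTheta (leadcols r U) (leadcols r Ut)) <= Num.min
    ((sv St r * opnorm (dA *m leadcols r Vt) +
      sv S r.+1 * opnorm (dA^T *m leadcols r Ut)) /
     (sv St r ^+ 2 - sv S r.+1 ^+ 2))
    ((sv S r * opnorm (dA *m leadcols r V) +
      sv St r.+1 * opnorm (dA^T *m leadcols r U)) /
     (sv S r ^+ 2 - sv St r.+1 ^+ 2)).
Proof.
move=> r0 rn rm svdA svdB gap gap'.
have [[UU _] _ _ _ _] := svdA; have [[UtUt _] _ _ _ _] := svdB.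
have U1U1 := leadcols_isometry (ltnW rn) UU.
have Ut1Ut1 := leadcols_isometry (ltnW rn) UtUt.
(* Viewing [A] as the perturbation of [A + dA] by [- dA] exchanges the two decompositions and yields
   the second bound, now on the projection of the columns of [leadcols r U]. *)
have svdA' : is_svd (A + dA + - dA) U S V by rewrite addrK.
have h1 := svd_proj_bound r0 rn rm svdA svdB gap.
have h2 := svd_proj_bound r0 rn rm svdB svdA' gap'.
rewrite [(- dA)^T]linearN /= !mulNmx !opnormN in h2.
rewrite le_min; apply/andP; split.
  apply: opnorm_sinTheta_le => //; first exact: le_trans (opnorm_ge0 _) h1.
  left=> x x1; rewrite mulmxA; apply: le_trans (opnorm_mul _ _) _.
  by rewrite x1 mulr1.
apply: opnorm_sinTheta_le => //; first exact: le_trans (opnorm_ge0 _) h2.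
right=> x x1; rewrite mulmxA; apply: le_trans (opnorm_mul _ _) _.
by rewrite x1 mulr1.
Qed.

(** The numerator is at most [(t + s) c], and [t + s] cancels against
    [t^2 - s^2 = (t - s)(t + s)]. *)
Lemma ratio_le (t s a b c : R) : 0 <= s -> s < t -> a <= c -> b <= c ->
  (t * a + s * b) / (t ^+ 2 - s ^+ 2) <= 1 / (t - s) * c.
Proof.
move=> s0 st ac bc; have t0 := le_lt_trans s0 st.
have ts : 0 < t - s by rewrite subr_gt0.
have ts' : 0 < t + s by rewrite ltr_wpDr.
rewrite subr_sqr ler_pdivrMr ?mulr_gt0 //.
have -> : 1 / (t - s) * c * ((t - s) * (t + s)) = t * c + s * c.
  by field; rewrite gt_eqF.
by apply: lerD; apply: ler_wpM2l => //; exact: ltW.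
Qed.

End SinTheta.

Theorem theorem3p1 (R : realType) (n m r : nat) (A dA : 'M[R]_(n, m))
    (U : 'M[R]_n) (S : 'M[R]_(n, m)) (V : 'M[R]_m)
    (Ut : 'M[R]_n) (St : 'M[R]_(n, m)) (Vt : 'M[R]_m) :
  (1 <= r)%N -> (r < minn n m)%N -> (r <= \rank A)%N ->
  is_svd A U S V -> is_svd (A + dA) Ut St Vt ->
  let s := sv S in let st := sv St in
  let U1 : 'M[R]_(n, r) := leadcols r U in
  let V1 : 'M[R]_(m, r) := leadcols r V in
  let Ut1 : 'M[R]_(n, r) := leadcols r Ut in
  let Vt1 : 'M[R]_(m, r) := leadcols r Vt in
  0 < s r - st r.+1 -> 0 < st r - s r.+1 ->
  let sinU := opnorm (sinTheta U1 Ut1) in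
  let sinV := opnorm (sinTheta V1 Vt1) in
  [/\ sinU <= Num.min
        ((st r * opnorm (dA *m Vt1) + s r.+1 * opnorm (dA^T *m Ut1))
           / (st r ^+ 2 - s r.+1 ^+ 2))
        ((s r * opnorm (dA *m V1) + st r.+1 * opnorm (U1^T *m dA))
           / (s r ^+ 2 - st r.+1 ^+ 2)),
      sinV <= Num.min
        ((st r * opnorm (Ut1^T *m dA) + s r.+1 * opnorm (dA *m Vt1))
           / (st r ^+ 2 - s r.+1 ^+ 2))
        ((s r * opnorm (U1^T *m dA) + st r.+1 * opnorm (dA *m V1))
           / (s r ^+ 2 - st r.+1 ^+ 2))
    & Num.max sinU sinV <=
        Num.min (1 / (s r - st r.+1)) (1 / (st r - s r.+1)) * opnorm dA].
Proof.
rewrite leq_min => r0 /andP[rn rm] _ svdA svdB s st U1 V1 Ut1 Vt1.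
rewrite !subr_gt0 => gap' gap sinU sinV.
(* Transposition exchanges left and right singular vectors, so the bound for [V] is the bound for
   [U] applied to [A^T]. *)
have svdB' : is_svd (A^T + dA^T) Vt St^T Ut.
  by rewrite -[A^T + _](linearD (trmx : 'M[R]_(n, m) -> _)); exact: is_svd_tr.
have hU := sinTheta_bounds r0 rn rm svdA svdB gap gap'.
have := sinTheta_bounds r0 rm rn (is_svd_tr svdA) svdB'.
rewrite !sv_tr trmxK => /(_ gap gap') hV.
rewrite -/s -/st -/U1 -/V1 -/Ut1 -/Vt1 -/sinU -/sinV in hU hV.
have trE (X : 'M[R]_(n, r)) : opnorm (X^T *m dA) = opnorm (dA^T *m X).
  by rewrite -opnorm_tr trmx_mul trmxK.
rewrite !trE; split => //.
have [[UU VV] _ _ _ _] := svdA; have [[UtUt VtVt] _ _ _ _] := svdB.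
have lV X : X^T *m X = 1%:M -> opnorm (dA *m leadcols r X) <= opnorm dA.
  by move=> XX; apply/opnorm_mulr_isometry/leadcols_isometry => //; exact: ltnW.
have lU X : X^T *m X = 1%:M -> opnorm (dA^T *m leadcols r X) <= opnorm dA.
  move=> XX; rewrite -(opnorm_tr dA).
  by apply/opnorm_mulr_isometry/leadcols_isometry => //; exact: ltnW.
have s0 := sv_ge0 r.+1 svdA; have st0 := sv_ge0 r.+1 svdB.
move: hU hV; rewrite !le_min => /andP[hU1 hU2] /andP[hV1 hV2].
(* Whichever reciprocal gap is the minimum, the earlier bound with the same gap in its denominator
   gives the estimate. *)
rewrite ge_max; have [_|_] := leP (1 / (s r - st r.+1)); apply/andP; split.
- by apply: le_trans hU2 (ratio_le _ _ _ _) => //; [exact: lV|exact: lU].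
- by apply: le_trans hV2 (ratio_le _ _ _ _) => //; [exact: lU|exact: lV].
- by apply: le_trans hU1 (ratio_le _ _ _ _) => //; [exact: lV|exact: lU].
- by apply: le_trans hV1 (ratio_le _ _ _ _) => //; [exact: lU|exact: lV].
Qed.
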